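(* Let $q$ be a prime power, $k\ge1$ an integer, $d$ an even integer with $2\le d\le 2k$, and let $\bar n=(n_1,\dots,n_l)\in\mathbb{N}^l$, where $l\ge 2$, be such that $\sum_{i=1}^l n_i=n$ and $n_i\ge k$ for all $1\le i\le l$. For $1\le i\le l$ let $\mathcal{C}_i$ be an $(n_i,\star,d;k)_q$-CDC and $\mathcal{M}_i$ a $(k\times n_i,\tfrac d2)_q$-rank metric code, and let $\mathcal{C}=\bigcup_{i=1}^l\mathcal{C}^i$, where $$\begin{aligned}\mathcal{C}^i=\Big\{R\left(M_1|\dots|M_{i-1}|\tau(U_i)|M_{i+1}|\dots|M_l\right)\,:\;& U_i\in\mathcal{C}_i,\ M_j\in\mathcal{M}_j\ \forall\,1\le j\le l,\ j\neq i,\\ &\text{and } \operatorname{rk}(M_j)\le k-\tfrac d2\ \forall\,1\le j<i\Big\}.\end{aligned}$$ Let $\bar a=(a_1,\dots,a_l)\in\mathbb{N}^l$ and $\bar b=(b_1,\dots,b_l)\in\mathbb{N}^l$ satisfy $\sum_{i=1}^l a_i=k$, $\sum_{i=1}^l b_i=k-\tfrac d2$, and $\tfrac d2\le a_i$, $b_i<a_i\le n_i$ for all $1\le i\le l$. For a positive integer $s$, let $\mathcal{D}_i^j$ be an $(n_i,\star,d;a_i)_q$-CDC for all $1\le i\le l$ and all $1\le j\le s$, such that $d(\mathcal{D}_i^{j_1},\mathcal{D}_i^{j_2})\ge 2a_i-2b_i$ for all $1\le i\le l$ and all $1\le j_1<j_2\le s$. Then there exists an $(n,\star,d;k)_q$-CDC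 $\mathcal{D}$ with cardinality $$\#\mathcal{D}=\sum_{j=1}^s\prod_{i=1}^l\#\mathcal{D}_i^j,$$ such that $\mathcal{C}\cap\mathcal{D}=\emptyset$ and $\mathcal{C}\cup\mathcal{D}$ is also an $(n,\star,d;k)_q$-CDC.
   Context: Here $\mathbb{N}$ includes $0$. The subspace distance between subspaces $U,U'$ of $\mathbb{F}_q^n$ is $d(U,U')=\dim(U+U')-\dim(U\cap U')$. An $(n,\star,d;k)_q$-CDC (constant-dimension code) is a set of $k$-dimensional subspaces of $\mathbb{F}_q^n$ any two distinct elements of which have subspace distance at least $d$; $\star$ means that the cardinality is not specified. For two CDCs $\mathcal{E},\mathcal{E}'$ in the same ambient space, $d(\mathcal{E},\mathcal{E}')\ge\delta$ means that every codeword of $\mathcal{E}$ has subspace distance at least $\delta$ to every codeword of $\mathcal{E}'$. A $(k\times m,\delta)_q$-rank metric code is a set of matrices in $\mathbb{F}_q^{k\times m}$ such that $\operatorname{rk}(M-M')\ge\delta$ for any two distinct elements $M,M'$. $R(M)$ denotes the row space of a matrix $M$, $(A|B|\dots)$ denotes horizontal concatenation of matrices, and $\tau(U)$ denotes the unique full-rank $k\times m$ matrix in reduced row echelon form whose row space is the $k$-dimensional subspace $U\le\mathbb{F}_q^m$. *)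

(* Defs.v *)
From HB Require Import structures.
From mathcomp Require Import all_boot all_algebra.

Set Implicit Arguments.
Unset Strict Implicit.
Unset Printing Implicit Defensive.

Import GRing.Theory.
Local Open Scope ring_scope.

(* MathComp gives {vspace vT} only a choiceType structure; over a finite field
   a subspace is determined by its (finite) canonical matrix. *)
HB.instance Definition _ (F : finFieldType) (vT : vectType F)
  : isCountable {vspace vT} := CanIsCountable (@VectorInternalTheory.vs2mxK F vT).
HB.instance Definition _ (F : finFieldType) (vT : vectType F)
  : isFinite {vspace vT} := CanIsFinite (@VectorInternalTheory.vs2mxK F vT).

Section Codes.
Variable F : finFieldType.

(* The truncated subtraction is exact, since U :&: U' is contained in U + U'. *)
Definition subspace_dist n (U U' : {vspace 'rV[F]_n}) : nat :=
  (\dim (U + U') - \dim (U :&: U'))%N.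

Definition is_cdc n (d k : nat) (C : {set {vspace 'rV[F]_n}}) : Prop :=
  (forall U, U \in C -> \dim U = k) /\
  (forall U U', U \in C -> U' \in C -> U != U' -> (d <= subspace_dist U U')%N).

Definition cdc_dist_ge n (delta : nat) (E E' : {set {vspace 'rV[F]_n}}) : Prop :=
  forall U U', U \in E -> U' \in E' -> (delta <= subspace_dist U U')%N.

Definition is_rank_metric_code k m (delta : nat) (M : {set 'M[F]_(k, m)}) : Prop :=
  forall A B, A \in M -> B \in M -> A != B -> (delta <= \rank (A - B)%R)%N.

Definition row_space k m (A : 'M[F]_(k, m)) : {vspace 'rV[F]_m} :=
  <<[seq row i A | i : 'I_k]>>%VS.

Definition leading k m (A : 'M[F]_(k, m)) (i : 'I_k) (j : 'I_m) : bool :=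
  (A i j != 0) && [forall j' : 'I_m, (j' < j)%N ==> (A i j' == 0)].

(* The first condition says both that the zero rows come last and that the
   leading entries move strictly to the right from one row to the next. *)
Definition is_rref k m (A : 'M[F]_(k, m)) : bool :=
  [forall i : 'I_k, forall i' : 'I_k, forall j' : 'I_m,
     (i < i')%N && leading A i' j' ==>
     [exists j : 'I_m, (j < j')%N && leading A i j]] &&
  [forall i : 'I_k, forall j : 'I_m,
     leading A i j ==>
     (A i j == 1) && [forall i' : 'I_k, (i' != i) ==> (A i' j == 0)]].

(* The default value 0 is only reached when \dim U != k, by tau_spec below. *)
Definition tau k m (U : {vspace 'rV[F]_m}) : 'M[F]_(k, m) :=
  odflt 0 [pick T : 'M[F]_(k, m) |
             [&& is_rref T, \rank T == k & row_space T == U]].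

Section Construction.
Variables (k d l : nat) (n_ : 'I_l -> nat).
Variables (C_ : forall i, {set {vspace 'rV[F]_(n_ i)}})
          (M_ : forall i, {set 'M[F]_(k, n_ i)}).

(* dfwith M T replaces the i-th component of the family M by T; thus M i is left
   unconstrained and plays no role. *)
Definition code_part (i : 'I_l) : {set {vspace 'rV[F]_(\sum_j n_ j)}} :=
  [set row_space (\mxrow_j dfwith M (tau k U) j)
     | U : {vspace 'rV[F]_(n_ i)} in C_ i,
       M : {dffun forall j : 'I_l, 'M[F]_(k, n_ j)} in
         [pred M : {dffun forall j : 'I_l, 'M[F]_(k, n_ j)} |
            [forall j, (j != i) ==> (M j \in M_ j)] &&
            [forall j : 'I_l, (j < i)%N ==> (\rank (M j) <= k - d./2)%N]]].

Definition multi_code : {set {vspace 'rV[F]_(\sum_j n_ j)}} :=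
  \bigcup_(i < l) code_part i.

End Construction.
End Codes.

Lemma row_spaceP (F : finFieldType) k m (A : 'M[F]_(k, m)) (u : 'rV_m) :
  reflect (exists v : 'rV_k, u = v *m A) (u \in row_space A).
Proof.
apply: (iffP idP) => [uA|[v ->]].
  pose X := [tuple row i A | i < k].
  have uX : u \in <<X>>%VS.
    exact: uA.
  exists (\row_i coord X i u).
  rewrite {1}(coord_span uX) mulmx_sum_row; apply: eq_bigr => i _.
  by rewrite -tnth_nth tnth_map tnth_ord_tuple mxE.
rewrite mulmx_sum_row; apply: memv_suml => i _.
by rewrite memvZ // memv_span //; apply: image_f.
Qed.

Lemma enum_val_ltn m (P : {set 'I_m}) (i j : 'I_#|P|) :
  (i < j)%N -> (enum_val i < enum_val j)%N.
Proof.
move=> ij.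
have s : sorted ltn [seq val x | x <- enum P].
  rewrite sorted_map /enum_mem -enumT.
  apply: sorted_filter; first by move=> x y z /=; apply: ltn_trans.
  by rewrite -sorted_map val_enum_ord iota_ltn_sorted.
have m0 : 'I_m := enum_val i.
have := sorted_ltn_nth ltn_trans 0%N s.
move=> /(_ i j); rewrite !inE size_map -cardE !ltn_ord => /(_ isT isT ij).
by rewrite !(nth_map m0) -?cardE // -!enum_val_nth.
Qed.

Lemma tau_spec (F : finFieldType) k m (U : {vspace 'rV[F]_m}) :
  \dim U = k ->
  [/\ is_rref (tau k U), \rank (tau k U) = k & row_space (tau k U) = U].
Proof.
move=> dU.
suff [T [rT kT sT]] : exists T : 'M[F]_(k, m),
    [/\ is_rref T, \rank T = k & row_space T = U].
  rewrite /tau; case: pickP => [S /and3P[rS /eqP kS /eqP sS]|/(_ T)] //=.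
  by rewrite rT kT sT !eqxx.
pose lead (u : 'rV[F]_m) (j : 'I_m) :=
  (u 0 j != 0) && [forall j' : 'I_m, (j' < j)%N ==> (u 0 j' == 0)].
pose P := [set j | [exists u, (u \in U) && lead u j]].
have leadE (u : 'rV[F]_m) : u \in U -> (forall j, j \in P -> u 0 j = 0) -> u = 0.
  move=> uU uP; apply/eqP/negPn/negP => u0.
  have /existsP[j0 uj0] : [exists j, u 0 j != 0].
    apply: contraNT u0; rewrite negb_exists => /forallP h.
    by apply/eqP/rowP => j; apply/eqP; rewrite mxE; have := h j; rewrite negbK.
  case: (@arg_minnP _ j0 (fun j => u 0 j != 0) val uj0) => j uj jmin.
  have jP : j \in P.
    rewrite inE; apply/existsP; exists u; rewrite uU /lead uj /=.
    apply/forallP => j'; apply/implyP => lj; apply/eqP/eqP.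
    by apply: contraLR lj => /jmin; rewrite -leqNgt.
  by rewrite uP ?eqxx in uj.
pose p : 'I_#|P| -> 'I_m := enum_val.
have pP i : exists u, (u \in U) && lead u (p i).
  by have := enum_valP i; rewrite inE => /existsP.
pose W := \matrix_(i < #|P|) xchoose (pP i).
have WU i : row i W \in U by rewrite rowK; have /andP[] := xchooseP (pP i).
have Wl i : lead (row i W) (p i) by rewrite rowK; have /andP[] := xchooseP (pP i).
pose S := colsub p W.
have Sunit : S \in unitmx.
  rewrite -unitmx_tr unitmxE det_trig; last first.
    apply/is_trig_mxP => i j ij; rewrite !mxE.
    have /andP[_ /forallP/(_ (p i))] := Wl j.
    by rewrite !mxE enum_val_ltn //= => /eqP.
  rewrite unitfE prodf_seq_neq0; apply/allP => i _ /=.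
  by have /andP[] := Wl i; rewrite !mxE.
pose T := invmx S *m W.
have Tp : colsub p T = 1%:M by rewrite -mulmx_colsub mulVmx.
have TpE i j : T i (p j) = (i == j)%:R.
  by have /matrixP/(_ i j) := Tp; rewrite !mxE.
have TU i : row i T \in U.
  rewrite row_mul mulmx_sum_row; apply: memv_suml => j _.
  by rewrite memvZ.
have sT : row_space T = U.
  apply/vspaceP => u; apply/row_spaceP/idP => [[v ->]|uU].
    rewrite mulmx_sum_row; apply: memv_suml => j _; by rewrite memvZ.
  exists (colsub p u); apply/eqP; rewrite -subr_eq0; apply/eqP; apply: leadE.
    rewrite memvB // mulmx_sum_row; apply: memv_suml => j _; by rewrite memvZ.
  move=> j jP; rewrite -(enum_rankK_in jP jP) -/(p _).
  set i := enum_rank_in _ _.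
  rewrite !mxE (bigD1 i) //= TpE eqxx mulr1 mxE big1 ?addr0 ?subrr // => l li.
  by rewrite TpE (negPf li) mulr0.
have rT : \rank T = #|P|.
  apply/eqP; apply/row_freeP; exists (colsub p 1%:M).
  by rewrite mulmx_colsub mulmx1.
have Tlead i j : leading T i j -> j = p i.
  move=> /andP[Tij /forallP Tl].
  have jP : j \in P.
    rewrite inE; apply/existsP; exists (row i T); rewrite TU /lead mxE Tij /=.
    apply/forallP => j'; rewrite mxE; exact: Tl.
  move: Tij; rewrite -(enum_rankK_in jP jP) -/(p _) TpE.
  by case: (i =P _) => [<-|_]; rewrite ?eqxx.
have leadT i : leading T i (p i).
  have : row i T != 0.
    apply/eqP => /rowP/(_ (p i)); rewrite mxE [RHS]mxE TpE eqxx => /eqP.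
    by rewrite oner_eq0.
  move=> r0; have [j] : exists j, leading T i j.
    apply/existsP; apply: contraNT r0; rewrite negb_exists => /forallP h.
    apply/eqP/rowP => j; rewrite mxE [RHS]mxE.
    have [n] := ubnP (val j); elim: n j => // n IH j jn.
    have := h j; rewrite negb_and negbK => /orP[/eqP //|].
    rewrite negb_forall => /existsP[j']; rewrite negb_imply => /andP[lj].
    by rewrite (IH j') ?eqxx //; exact: leq_trans lj jn.
  by move=> Tj; rewrite -(Tlead _ _ Tj).
have rrT : is_rref T.
  apply/andP; split.
    apply/forallP => i; apply/forallP => i'; apply/forallP => j'.
    apply/implyP => /andP[ii' /Tlead ->]; apply/existsP; exists (p i).
    by rewrite enum_val_ltn // leadT.
  apply/forallP => i; apply/forallP => j; apply/implyP => /Tlead ->.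
  rewrite TpE eqxx eqxx /=; apply/forallP => i'; apply/implyP => ii'.
  by rewrite TpE (negPf ii').
have kP : k = #|P|.
  rewrite -dU -sT; pose X := [tuple row i T | i < #|P|].
  have -> : row_space T = <<X>>%VS by [].
  have /eqP -> : free X; last by rewrite size_tuple.
  apply/freeP => c c0 i; have /rowP/(_ (p i)) := c0.
  have XE j : (c j *: X`_j) 0 (p i) = c j * (j == i)%:R.
    by rewrite -tnth_nth tnth_mktuple mxE [X in _ * X]mxE TpE.
  rewrite summxE (bigD1 i) //= big1 => [|j ji].
    by rewrite XE eqxx mulr1 addr0 mxE.
  by rewrite XE (negPf ji) mulr0.
by rewrite kP; exists T.
Qed.

(* Main.v *)
Require Import Defs.
From mathcomp Require Import all_boot all_algebra zify.

Set Implicit Arguments.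
Unset Strict Implicit.
Unset Printing Implicit Defensive.

Import GRing.Theory.

(** Two subspaces of dimension k are at distance at least d = 2e exactly when
    their intersection has dimension at most k - e ([subspace_dist_ge]), so
    everything reduces to bounding dimensions of intersections. Throughout, the
    ambient space is the direct sum of l blocks, and [block_proj i] projects
    onto the i-th one.

    The code D consists of the direct sums of U_1, ..., U_l with U_i in D_i^j,
    for all layers j at once. Intersections of direct sums are computed
    blockwise. In one layer, two distinct families differ in some block i, where
    the intersection loses at least d/2 dimensions out of a_i, and the a_i sum
    to k. In two different layers each block contributes at most b_i, and the
    b_i sum to k - d/2 ([dim_cap_dsum_codes]). As k - d/2 < k, distinct pairs of
    a layer and a family give distinct direct sums, hence the cardinality.

    A codeword of C^i is the row space of a matrix A whose i-th block is
    tau(U_i), of full rank, so projection onto block i is injective on it and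
    its intersection with any V is no larger than a subspace containing the
    block-i projection of that intersection ([dim_cap_le_block]).
    - Against a codeword of C^i' with i < i', the projection lies in the row
      space of a matrix of rank at most k - d/2.
    - Against a codeword of C^i with another U_i, it lies in the intersection of
      two distinct codewords of C_i.
    - Against a codeword of C^i with the same U_i, a common vector has the same
      coordinates in both, so these are in the kernel of M_j - M'_j for all j,
      and the rank distance bounds that kernel.
    - Against a direct sum from D, it lies in a space of dimension a_i, and
      a_i <= k - d/2 because some other a_i' is at least d/2. *)

(** * Distance and row spaces *)

Lemma subspace_dist_ge (F : finFieldType) n k e (U V : {vspace 'rV[F]_n}) :
  \dim U = k -> \dim V = k ->
  (2 * e <= subspace_dist U V) = (\dim (U :&: V) + e <= k).
Proof.
move=> dU dV; rewrite /subspace_dist.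
have := dimv_sum_cap U V; have := dimvS (capvSl U V); rewrite dU dV.
by lia.
Qed.

(** The row space of A is spanned by the rows of [row_base A], and there are
    \rank A of them. *)
Lemma dim_row_space (F : finFieldType) k m (A : 'M[F]_(k, m)) :
  \dim (row_space A) <= \rank A.
Proof.
have : (row_space A <= row_space (row_base A))%VS.
  apply/subvP => u /row_spaceP[v ->]; apply/row_spaceP.
  by apply/submxP; rewrite eq_row_base submxMl.
move=> /dimvS /leq_trans; apply.
by apply: leq_trans (dim_span _) _; rewrite size_map -cardE card_ord.
Qed.

(** * Blocks and direct sums *)

Section Blocks.
Variables (F : finFieldType) (l : nat) (n_ : 'I_l -> nat).
Local Open Scope ring_scope.
Local Notation n := (\sum_j n_ j)%N.

(** Projection of the ambient space onto its i-th block; it agrees with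
    [submxrow] by [block_projE]. *)
Definition block_proj i : 'Hom('rV[F]_n, 'rV[F]_(n_ i)) :=
  linfun (mulmxr (submxrow 1%:M i)).

(** Inclusion of the i-th block, extending a vector by zero. *)
Definition block_inj i : 'Hom('rV[F]_(n_ i), 'rV[F]_n) :=
  linfun (mulmxr (submxcol 1%:M i)).

Lemma block_projE i (u : 'rV[F]_n) : block_proj i u = submxrow u i.
Proof. by rewrite lfunE /= mul_submxrow mulmx1. Qed.

Lemma sum_block_inj (w : forall i, 'rV[F]_(n_ i)) :
  \sum_i block_inj i (w i) = \mxrow_i w i.
Proof.
rewrite -[RHS]mulmx1 -[X in _ *m X]submxcolK mul_mxrow_mxcol.
by apply: eq_bigr => i _; rewrite lfunE.
Qed.

(** The direct sum of one subspace in each block. *)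
Definition dsum (U : forall i, {vspace 'rV[F]_(n_ i)}) : {vspace 'rV[F]_n} :=
  (\sum_i block_inj i @: U i)%VS.

Lemma mem_dsum (U : forall i, {vspace 'rV[F]_(n_ i)}) (u : 'rV[F]_n) :
  reflect (forall i, submxrow u i \in U i) (u \in dsum U).
Proof.
apply: (iffP memv_sumP) => [[v vU ->] i|uU].
  have {}vU j : exists w, (w \in U j) && (v j == block_inj j w).
    by have /memv_imgP[w wU ->] := vU j isT; exists w; rewrite wU eqxx.
  rewrite (eq_bigr (fun j => block_inj j (xchoose (vU j)))); last first.
    by move=> j _; have /andP[_ /eqP] := xchooseP (vU j).
  by rewrite sum_block_inj mxrowK; have /andP[] := xchooseP (vU i).
exists (fun i => block_inj i (submxrow u i)) => [i _|].
  by apply: memv_img; exact: uU.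
by rewrite (sum_block_inj (fun i => submxrow u i)) submxrowK.
Qed.

Lemma cap_dsum (U V : forall i, {vspace 'rV[F]_(n_ i)}) :
  (dsum U :&: dsum V)%VS = dsum (fun i => (U i :&: V i)%VS).
Proof.
apply/vspaceP => u; rewrite memv_cap.
apply/andP/mem_dsum => [[/mem_dsum uU /mem_dsum uV] i|uUV].
  by rewrite memv_cap uU uV.
by split; apply/mem_dsum => i; have := uUV i; rewrite memv_cap => /andP[].
Qed.

Lemma block_injK i : cancel (block_inj i) (block_proj i).
Proof.
move=> w; rewrite block_projE lfunE /= -mul_submxrow -submxblockEv.
by rewrite -mxdiagZ submxblock_diag mulmx1.
Qed.

Lemma dim_dsum (U : forall i, {vspace 'rV[F]_(n_ i)}) :
  \dim (dsum U) = (\sum_i \dim (U i))%N.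
Proof.
(* Each summand is recovered from the sum by projecting onto its block. *)
have : directv (\sum_i block_inj i @: U i).
  apply/directv_sum_independent => v vU v0 i _.
  have {}vU j : v j = block_inj j (block_proj j (v j)).
    by have /memv_imgP[w _ ->] := vU j isT; rewrite block_injK.
  have := v0; rewrite (eq_bigr _ (fun j _ => vU j)).
  rewrite (sum_block_inj (fun j => block_proj j (v j))).
  move=> /(congr1 (fun u => submxrow u i)).
  by rewrite mxrowK submxrow0 => vi0; rewrite vU vi0 linear0.
move=> /directvP /= ->; apply: eq_bigr => i _.
rewrite limg_dim_eq //; apply/eqP; rewrite -subv0; apply/subvP => w.
rewrite memv_cap memv_ker => /andP[_ /eqP w0].
by rewrite -[w]block_injK w0 linear0 mem0v.
Qed.

(** When block i of A has full row rank, projection onto block i is injective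
    on the row space of A. *)
Lemma dim_cap_le_block k i (A : 'M[F]_(k, n)) (V : {vspace 'rV[F]_n})
    (Z : {vspace 'rV[F]_(n_ i)}) :
  row_free (submxrow A i) ->
  (forall u, u \in row_space A -> u \in V -> submxrow u i \in Z) ->
  (\dim (row_space A :&: V) <= \dim Z)%N.
Proof.
move=> Afree VZ.
rewrite -(@limg_dim_eq _ _ _ (block_proj i)); last first.
  apply/eqP; rewrite -subv0; apply/subvP => u; rewrite !memv_cap memv_ker.
  move=> /andP[/andP[/row_spaceP[v ->] _]]; rewrite block_projE -mul_submxrow.
  by rewrite mulmx_free_eq0 // => /eqP ->; rewrite mul0mx mem0v.
apply: dimvS; apply/subvP => w /memv_imgP[u].
rewrite memv_cap => /andP[uA uV] ->.
by rewrite block_projE; apply: VZ.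
Qed.

Lemma dim_row_space_block k i (A : 'M[F]_(k, n)) :
  row_free (submxrow A i) ->
  \dim (row_space (submxrow A i)) = k -> \dim (row_space A) = k.
Proof.
move=> Afree dAi; apply/eqP; rewrite eqn_leq.
rewrite (leq_trans (dim_row_space A) (rank_leq_row A)) /= -{1}dAi.
rewrite -(limg_ker_dim (block_proj i) (row_space A)).
rewrite (leq_trans _ (leq_addl _ _)) //.
apply: dimvS; apply/subvP => w /row_spaceP[v ->].
rewrite mul_submxrow -block_projE memv_img //.
by apply/row_spaceP; exists v.
Qed.

(** A common vector of two row spaces that share a full-rank block has the same
    coordinates v with respect to A and B, whence v (A_j - B_j) = 0. *)
Lemma dim_cap_eq_block k i (A B : 'M[F]_(k, n)) j :
  row_free (submxrow A i) -> submxrow A i = submxrow B i ->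
  (\dim (row_space A :&: row_space B) <=
     k - \rank (submxrow A j - submxrow B j)%R)%N.
Proof.
move=> Afree eqAB; rewrite -mxrank_ker.
set K := kermx _.
apply: leq_trans (leq_trans (dim_row_space (K *m A)) (mxrankM_maxl _ _)).
apply: dimvS; apply/subvP => u; rewrite memv_cap.
move=> /andP[/row_spaceP[v ->] /row_spaceP[w eqvw]].
have vw : v = w.
  by apply: (row_free_inj Afree); rewrite [in RHS]eqAB !mul_submxrow eqvw.
apply/row_spaceP; have /submxP[x ->] : (v <= K)%MS.
  by rewrite sub_kermx mulmxBr !mul_submxrow eqvw vw subrr.
by exists x; rewrite -mulmxA.
Qed.

End Blocks.

(** * The code C *)

Section MultiCode.
Variables (F : finFieldType) (k d l : nat) (n_ : 'I_l -> nat).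
Variables (C_ : forall i, {set {vspace 'rV[F]_(n_ i)}})
          (M_ : forall i, {set 'M[F]_(k, n_ i)}).
Hypothesis C_cdc : forall i, is_cdc d k (C_ i).
Local Notation n := (\sum_j n_ j)%N.

(** The block form of codewords: replacing component i of the family by tau(U)
    is expressed through the blocks of a single matrix A. *)
Lemma multi_codeP (W : {vspace 'rV[F]_n}) : W \in multi_code d C_ M_ ->
  exists i (U : {vspace 'rV[F]_(n_ i)}) (A : 'M[F]_(k, n)),
    [/\ W = row_space A, U \in C_ i, submxrow A i = tau k U,
        forall j, j != i -> submxrow A j \in M_ j &
        forall j : 'I_l, j < i -> \rank (submxrow A j) <= k - d./2].
Proof.
move=> /bigcupP[i _ /imset2P[U M UC]].
rewrite inE => /andP[/forallP MM /forallP Mr] ->.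
exists i, U, (\mxrow_j dfwith M (tau k U) j)%R; split=> // [|j ji|j ji].
- by rewrite mxrowK dfwith_in.
- by rewrite mxrowK dfwith_out 1?eq_sym //; apply: implyP (MM j) ji.
- rewrite mxrowK dfwith_out; first exact: implyP (Mr j) ji.
  by rewrite neq_ltn ji orbT.
Qed.

Lemma tau_block_spec i (U : {vspace 'rV[F]_(n_ i)}) (A : 'M[F]_(k, n)) :
  U \in C_ i -> submxrow A i = tau k U ->
  [/\ \dim U = k, row_free (submxrow A i) & row_space (submxrow A i) = U].
Proof.
move=> UC ->; have dU := (C_cdc i).1 _ UC.
by have [_ tk tU] := tau_spec dU; split=> //; rewrite /row_free tk.
Qed.

Lemma submxrow_row_space i (A : 'M[F]_(k, n)) (u : 'rV[F]_n) :
  u \in row_space A -> submxrow u i \in row_space (submxrow A i).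
Proof.
move=> /row_spaceP[v ->]; rewrite -mul_submxrow.
by apply/row_spaceP; exists v.
Qed.

Lemma dim_multi_code (W : {vspace 'rV[F]_n}) :
  W \in multi_code d C_ M_ -> \dim W = k.
Proof.
move=> /multi_codeP[i [U [A [-> UC Ai _ _]]]].
have [dU Afree AU] := tau_block_spec UC Ai.
by apply: (dim_row_space_block Afree); rewrite AU.
Qed.

(** Used with B the matrix of a codeword of a later part, whose block i has
    rank at most k - d/2 by the rank restriction in the construction. *)
Lemma dim_cap_distinct_parts i (U : {vspace 'rV[F]_(n_ i)})
    (A B : 'M[F]_(k, n)) :
  d./2 <= k -> U \in C_ i -> submxrow A i = tau k U ->
  \rank (submxrow B i) <= k - d./2 ->
  \dim (row_space A :&: row_space B) + d./2 <= k.
Proof.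
move=> dk UC Ai Bi; have [_ Afree _] := tau_block_spec UC Ai.
have : \dim (row_space A :&: row_space B) <= k - d./2; last by lia.
apply: leq_trans (leq_trans (dim_row_space _) Bi).
by apply: (dim_cap_le_block Afree) => u _; apply: submxrow_row_space.
Qed.

(** If U = V, the codewords differ in a rank-metric block; otherwise the
    intersection embeds into U :&: V. *)
Lemma dim_cap_same_part i (U V : {vspace 'rV[F]_(n_ i)})
    (A B : 'M[F]_(k, n)) :
  ~~ odd d -> (forall j, is_rank_metric_code d./2 (M_ j)) ->
  U \in C_ i -> submxrow A i = tau k U ->
  V \in C_ i -> submxrow B i = tau k V ->
  (forall j, j != i -> submxrow A j \in M_ j) ->
  (forall j, j != i -> submxrow B j \in M_ j) ->
  row_space A != row_space B ->
  \dim (row_space A :&: row_space B) + d./2 <= k.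
Proof.
move=> d_even M_rmc UC Ai VC Bi AM BM neqAB.
have [dU Afree AU] := tau_block_spec UC Ai.
have [dV Bfree BV] := tau_block_spec VC Bi.
have d2 : d = 2 * d./2 by lia.
have [eqUV|neqUV] := eqVneq U V.
  have eqAi : submxrow A i = submxrow B i by rewrite Ai Bi eqUV.
  have [j neqj] : exists j, submxrow A j != submxrow B j.
    apply/existsP; apply: contraR neqAB; rewrite negb_exists => /forallP eqAB.
    suff -> : A = B by [].
    by apply/mxrowP => j; apply/eqP; have := eqAB j; rewrite negbK.
  have ji : j != i by apply: contraNneq neqj => ->; rewrite eqAi.
  rewrite -[leqRHS](subnK (rank_leq_row (submxrow A j - submxrow B j)%R)).
  apply: leq_add; first exact: (dim_cap_eq_block j Afree eqAi).
  exact: M_rmc (AM j ji) (BM j ji) neqj.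
have := (C_cdc i).2 _ _ UC VC neqUV.
rewrite [X in X <= _]d2 (subspace_dist_ge _ dU dV); apply: leq_trans.
rewrite leq_add2r; apply: (dim_cap_le_block Afree) => u uA uB.
by rewrite memv_cap -AU -BV !submxrow_row_space.
Qed.

Lemma dim_cap_multi_code (W W' : {vspace 'rV[F]_n}) :
  ~~ odd d -> d./2 <= k -> (forall i, is_rank_metric_code d./2 (M_ i)) ->
  W \in multi_code d C_ M_ -> W' \in multi_code d C_ M_ -> W != W' ->
  \dim (W :&: W') + d./2 <= k.
Proof.
move=> d_even dk M_rmc.
move=> /multi_codeP[i [U [A [-> UC Ai AM Ar]]]].
move=> /multi_codeP[i' [V [B [-> VC Bi BM Br]]]] neqAB.
have [ii'|i'i|/val_inj eqi] := ltngtP i i'.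
- exact: dim_cap_distinct_parts dk UC Ai (Br i ii').
- by rewrite capvC; apply: dim_cap_distinct_parts dk VC Bi (Ar i' i'i).
- subst i'; exact: (dim_cap_same_part d_even M_rmc UC Ai VC Bi AM BM neqAB).
Qed.

Lemma dim_cap_dsum_multi_code (W : {vspace 'rV[F]_n})
    (X : forall i, {vspace 'rV[F]_(n_ i)}) e :
  (forall i, \dim (X i) + e <= k) -> W \in multi_code d C_ M_ ->
  \dim (W :&: dsum X) + e <= k.
Proof.
move=> Xe /multi_codeP[i [U [A [-> UC Ai _ _]]]].
have [dU Afree _] := tau_block_spec UC Ai.
apply: leq_trans (Xe i); rewrite leq_add2r.
by apply: (dim_cap_le_block Afree) => u _ /mem_dsum.
Qed.

End MultiCode.

(** * The code D *)

Section DirectSumCode.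
Variables (F : finFieldType) (l s : nat) (n_ : 'I_l -> nat).
Variables (D_ : forall i, 'I_s -> {set {vspace 'rV[F]_(n_ i)}}).
Local Notation n := (\sum_j n_ j)%N.

(** The j-th layer of D: all direct sums of one codeword from each D_i^j. *)
Definition dsum_code (j : 'I_s) : {set {vspace 'rV[F]_n}} :=
  [set dsum U | U : {dffun forall i : 'I_l, {vspace 'rV[F]_(n_ i)}}
                  in setXn (fun i => D_ i j)].

Variables (k d : nat) (a b : 'I_l -> nat).
Hypothesis d_even : ~~ odd d.
Hypothesis dk : d./2 <= k.
Hypothesis sum_a : \sum_i a i = k.
Hypothesis sum_b : \sum_i b i = k - d./2.
Hypothesis ba : forall i, b i <= a i.
Hypothesis D_cdc : forall i j, is_cdc d (a i) (D_ i j).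
Hypothesis D_dist : forall i (j1 j2 : 'I_s), j1 < j2 ->
  cdc_dist_ge (2 * a i - 2 * b i) (D_ i j1) (D_ i j2).

Lemma dim_dsum_code j W : W \in dsum_code j -> \dim W = k.
Proof.
move=> /imsetP[U /setXnP UD ->]; rewrite dim_dsum -sum_a.
by apply: eq_bigr => i _; exact: (D_cdc i j).1 _ (UD i).
Qed.

Lemma dim_cap_dsum_neq_layer (j1 j2 : 'I_s) W W' :
  j1 < j2 -> W \in dsum_code j1 -> W' \in dsum_code j2 ->
  \dim (W :&: W') + d./2 <= k.
Proof.
move=> j12 /imsetP[U /setXnP UD ->] /imsetP[V /setXnP VD ->].
rewrite cap_dsum dim_dsum -[leqRHS](subnK dk) leq_add2r -sum_b.
apply: leq_sum => i _.
have := D_dist j12 (UD i) (VD i).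
rewrite -mulnBr (subspace_dist_ge _ ((D_cdc i j1).1 _ (UD i))
  ((D_cdc i j2).1 _ (VD i))).
by rewrite -[X in _ <= X -> _](subnKC (ba i)) leq_add2r.
Qed.

(** The hypothesis U != V concerns the families, not their direct sums, so that
    injectivity of [dsum] on a layer follows. *)
Lemma dim_cap_dsum_layer j
    (U V : {dffun forall i : 'I_l, {vspace 'rV[F]_(n_ i)}}) :
  U \in setXn (fun i => D_ i j) -> V \in setXn (fun i => D_ i j) -> U != V ->
  \dim (dsum U :&: dsum V) + d./2 <= k.
Proof.
move=> /setXnP UD /setXnP VD neqUV.
have [i neqi] : exists i, U i != V i.
  apply/existsP; apply: contraR neqUV; rewrite negb_exists => /forallP eqUV.
  by apply/eqP/ffunP => i; apply/eqP; have := eqUV i; rewrite negbK.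
have d2 : d = 2 * d./2 by lia.
have := (D_cdc i j).2 _ _ (UD i) (VD i) neqi.
rewrite [X in X <= _]d2 (subspace_dist_ge _ ((D_cdc i j).1 _ (UD i))
  ((D_cdc i j).1 _ (VD i))) => capi.
rewrite cap_dsum dim_dsum -sum_a (bigD1 i) //= [leqRHS](bigD1 i) //= addnAC.
apply: leq_add => //; apply: leq_sum => i' _.
by rewrite -((D_cdc i' j).1 _ (UD i')) dimvS // capvSl.
Qed.

Lemma dim_cap_dsum_codes W W' :
  W \in \bigcup_j dsum_code j -> W' \in \bigcup_j dsum_code j -> W != W' ->
  \dim (W :&: W') + d./2 <= k.
Proof.
move=> /bigcupP[j1 _ W1] /bigcupP[j2 _ W2] neqW.
have [j12|j21|/val_inj eqj] := ltngtP j1 j2.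
- exact: dim_cap_dsum_neq_layer j12 W1 W2.
- by rewrite capvC; apply: dim_cap_dsum_neq_layer j21 W2 W1.
- subst j2; case/imsetP: W1 neqW => U UD ->; case/imsetP: W2 => V VD -> neqUV.
  by apply: (dim_cap_dsum_layer UD VD); apply: contraNneq neqUV => ->.
Qed.

Hypothesis d_gt1 : 1 < d.

Lemma dsum_inj j : {in setXn (fun i => D_ i j) &,
  injective (fun U : {dffun forall i : 'I_l, {vspace 'rV[F]_(n_ i)}} =>
               dsum U)}.
Proof.
move=> U V UD VD eqUV; apply/eqP; apply: contraT => neqUV.
have := dim_cap_dsum_layer UD VD neqUV; rewrite -eqUV capvv.
by rewrite (@dim_dsum_code j) ?imset_f //; lia.
Qed.

Lemma card_dsum_codes :
  #|\bigcup_j dsum_code j| = \sum_j \prod_i #|D_ i j|.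
Proof.
rewrite -sum1_card partition_disjoint_bigcup => [|j1 j2 neqj].
  apply: eq_bigr => j _; rewrite sum1_card card_in_imset ?cardsXn //.
  exact: dsum_inj.
(* Distinct layers are disjoint: W in both would give k <= k - d/2. *)
rewrite -setI_eq0; apply/eqP/setP => W; rewrite !inE; apply/negP.
move=> /andP[W1 W2]; have dW := dim_dsum_code W1.
move: neqj; rewrite neq_ltn => /orP[j12|j21].
  by have := dim_cap_dsum_neq_layer j12 W1 W2; rewrite capvv; lia.
by have := dim_cap_dsum_neq_layer j21 W2 W1; rewrite capvv; lia.
Qed.

End DirectSumCode.

Theorem lemma4p4 (F : finFieldType) (k d l : nat) (n_ : 'I_l -> nat)
    (C_ : forall i : 'I_l, {set {vspace 'rV[F]_(n_ i)}})
    (M_ : forall i : 'I_l, {set 'M[F]_(k, n_ i)})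
    (a b : 'I_l -> nat) (s : nat)
    (D_ : forall i : 'I_l, 'I_s -> {set {vspace 'rV[F]_(n_ i)}}) :
  1 <= k -> ~~ odd d -> 2 <= d <= 2 * k -> 2 <= l ->
  (forall i, k <= n_ i) ->
  (forall i, is_cdc d k (C_ i)) ->
  (forall i, is_rank_metric_code d./2 (M_ i)) ->
  \sum_(i < l) a i = k ->
  \sum_(i < l) b i = k - d./2 ->
  (forall i, [/\ d./2 <= a i, b i < a i & a i <= n_ i]) ->
  0 < s ->
  (forall i j, is_cdc d (a i) (D_ i j)) ->
  (forall i (j1 j2 : 'I_s), j1 < j2 ->
     cdc_dist_ge (2 * a i - 2 * b i) (D_ i j1) (D_ i j2)) ->
  exists D : {set {vspace 'rV[F]_(\sum_(i < l) n_ i)}},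
    [/\ is_cdc d k D,
        #|D| = \sum_(j < s) \prod_(i < l) #|D_ i j|,
        multi_code d C_ M_ :&: D = set0 &
        is_cdc d k (multi_code d C_ M_ :|: D)].
Proof.
move=> _ d_even /andP[d_ge2 d_le] l_ge2 _ C_cdc M_rmc sum_a sum_b ab _.
move=> D_cdc D_dist.
have dk : d./2 <= k by lia.
have d2 : d = 2 * d./2 by lia.
have ba i : b i <= a i by have [_ /ltnW] := ab i.
(* A second index exists because l >= 2, and it takes up at least d/2 of k. *)
have a_le i : a i + d./2 <= k.
  have [i' i'i] : exists i' : 'I_l, i' != i.
    have l_gt0 : 0 < l by lia.
    have [->|i0] := eqVneq i (Ordinal l_gt0); first by exists (Ordinal l_ge2).
    by exists (Ordinal l_gt0); rewrite eq_sym.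
  rewrite -sum_a (bigD1 i) //= leq_add2l (bigD1 i') //=.
  by have [da _ _] := ab i'; apply: leq_trans da (leq_addr _ _).
pose D := \bigcup_j dsum_code D_ j.
have dimC W : W \in multi_code d C_ M_ -> \dim W = k by apply: dim_multi_code.
have dimD W : W \in D -> \dim W = k.
  by move=> /bigcupP[j _]; apply: (dim_dsum_code sum_a D_cdc).
have capC W W' := @dim_cap_multi_code _ _ _ _ _ _ _ C_cdc W W' d_even dk M_rmc.
have capD W W' : W \in D -> W' \in D -> W != W' -> \dim (W :&: W') + d./2 <= k.
  exact: (dim_cap_dsum_codes d_even dk sum_a sum_b ba D_cdc D_dist).
have capCD W W' : W \in multi_code d C_ M_ -> W' \in D ->
    \dim (W :&: W') + d./2 <= k.
  move=> WC /bigcupP[j _ /imsetP[U /setXnP UD ->]].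
  apply: (dim_cap_dsum_multi_code C_cdc) WC => i.
  by rewrite ((D_cdc i j).1 _ (UD i)).
have cdcP (E : {set {vspace 'rV[F]_(\sum_(i < l) n_ i)}}) :
    (forall W, W \in E -> \dim W = k) ->
    (forall W W', W \in E -> W' \in E -> W != W' ->
       \dim (W :&: W') + d./2 <= k) -> is_cdc d k E.
  move=> dimE capE; split=> // W W' WE WE' neqW.
  by rewrite d2 (subspace_dist_ge _ (dimE _ WE) (dimE _ WE')) capE.
exists D; split.
- exact: cdcP.
- exact: (card_dsum_codes d_even dk sum_a sum_b ba D_cdc D_dist).
(* A common codeword W would have k = dim (W :&: W) <= k - d/2. *)
- apply/setP => W; rewrite !inE; apply/negP => /andP[WC WD].
  by have := capCD W W WC WD; rewrite capvv dimC //; lia.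
- apply: cdcP => [W|W W']; rewrite !inE; first by case/orP; auto.
  move=> /orP[WC|WD] /orP[WC'|WD'] neqW; auto.
  by rewrite capvC capCD.
Qed.
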